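(* Consider a radial network with the data, the relaxed problem SOCP, the quantities $\hat S,\hat P,\hat Q,\hat v$, the set $\mathcal{S}_{\mathrm{volt}}$, and the leaf-path notation defined in the context. Assume that $f_0$ is strictly increasing, and that $\overline{p}_i,\overline{q}_i\in\mathbb{R}$ ($i\in\mathcal{N}^+$) are such that $\mathcal{S}_i\subseteq\{s\in\mathbb{C}\mid \mathrm{Re}(s)\le\overline{p}_i,\ \mathrm{Im}(s)\le\overline{q}_i\}$ for all $i\in\mathcal{N}^+$. Let $u_i\in\mathbb{R}^2$ and $\underline{A}_i\in\mathbb{R}^{2\times 2}$ ($i\in\mathcal{N}^+$) be defined from these data as in the context. Suppose that: (C1) $\underline{A}_{l_s}\underline{A}_{l_{s+1}}\cdots\underline{A}_{l_{t-1}}u_{l_t}>0$ (componentwise) for every leaf $l\in\mathcal{L}$ and all integers $s,t$ with $1\le s\le t\le n_l$ (for $s=t$ the expression is $u_{l_t}$); (C2) every optimal solution $w=(s,S,v,\ell,s_0)$ of SOCP satisfies $s\in\mathcal{S}_{\mathrm{volt}}$. Then SOCP is exact, i.e., every optimal solution $(s,S,v,\ell,s_0)$ of SOCP satisfies $\ell_{ij}=|S_{ij}|^2/v_i$ for all $(i,j)\in\mathcal{E}$.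
   Context: Network. Let $n\ge 1$, $\mathcal{N}=\{0,1,\dots,n\}$ (buses), $\mathcal{N}^+=\mathcal{N}\setminus\{0\}$. The network is a tree on $\mathcal{N}$ rooted at bus $0$. Each line is an ordered pair $(i,j)$ of adjacent buses where $j$ lies on the unique path from $i$ to $0$; thus each $i\in\mathcal{N}^+$ has exactly one line $(i,j)$ leaving it. $\mathcal{E}$ is the set of lines, and $i\to j$ means $(i,j)\in\mathcal{E}$. $\mathcal{P}_i$ denotes the path from $i$ to $0$ (the collection of its buses, including $i$ and $0$, and of its lines). Each line has impedance $z_{ij}=r_{ij}+\mathbf{i}x_{ij}$ with $r_{ij}>0$, $x_{ij}>0$ ($\mathbf{i}$ is the imaginary unit). The squared substation voltage magnitude $v_0\geq 0$ is a given constant. For $i\in\mathcal{N}^+$ voltage bounds $\underline{v}_i,\overline{v}_i$ are given with $\underline{v}_i>0$, and $\mathcal{S}_i\subseteq\mathbb{C}$ is a given set (not necessarily convex or connected). For $i\in\mathcal{N}$, $f_i:\mathbb{R}\to\mathbb{R}$ is a given function (not necessarily convex). Variables. $s=(s_i)_{i\in\mathcal{N}^+}\in\mathbb{C}^n$, $S=(S_{ij})_{(i,j)\in\mathcal{E}}$ complex, $v=(v_i)_{i\in\mathcal{N}^+}$ real, $\ell=(\ell_{ij})_{(i,j)\in\mathcal{E}}$ real, $s_0\in\mathbb{C}$. SOCP is the problem: minimize $\sum_{i\in\mathcal{N}}f_i(\mathrm{Re}(s_i))$ over $(s,S,v,\ell,s_0)$ subject to - $S_{ij}=s_i+\sum_{h:\,h\to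 i}(S_{hi}-z_{hi}\ell_{hi})$ for all $(i,j)\in\mathcal{E}$; - $0=s_0+\sum_{h:\,h\to 0}(S_{h0}-z_{h0}\ell_{h0})$; - $v_i-v_j=2\mathrm{Re}(\bar z_{ij}S_{ij})-|z_{ij}|^2\ell_{ij}$ for all $(i,j)\in\mathcal{E}$; - $\ell_{ij}\ge |S_{ij}|^2/v_i$ for all $(i,j)\in\mathcal{E}$; - $s_i\in\mathcal{S}_i$ and $\underline{v}_i\le v_i\le\overline{v}_i$ for all $i\in\mathcal{N}^+$. (It relaxes the optimal power flow problem OPF, which has $\ell_{ij}=|S_{ij}|^2/v_i$ in place of the inequality.) A ''solution'' means a global minimizer. Lossless quantities. For $s=p+\mathbf{i}q\in\mathbb{C}^n$ ($p,q\in\mathbb{R}^n$) and $(i,j)\in\mathcal{E}$: $\hat S_{ij}(s)=\sum_{h:\,i\in\mathcal{P}_h}s_h$, $\hat P_{ij}(p)=\sum_{h:\,i\in\mathcal{P}_h}p_h$, $\hat Q_{ij}(q)=\sum_{h:\,i\in\mathcal{P}_h}q_h$; for $i\in\mathcal{N}$: $\hat v_i(s)=v_0+2\sum_{(j,k)\in\mathcal{P}_i}\mathrm{Re}(\bar z_{jk}\hat S_{jk}(s))$. Define $\mathcal{S}_{\mathrm{volt}}=\{s\in\mathbb{C}^n\mid \hat v_i(s)\le\overline{v}_i\text{ for all }i\in\mathcal{N}^+\}$. Matrices. With $a^+=\max\{a,0\}$, $I$ the $2\times2$ identity, $\overline{p}=(\overline{p}_i)_{i\in\mathcal{N}^+}$,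 $\overline{q}=(\overline{q}_i)_{i\in\mathcal{N}^+}$, and $(i,j)$ the unique line leaving $i\in\mathcal{N}^+$: $u_i=\begin{pmatrix} r_{ij} \\ x_{ij} \end{pmatrix}$ and $\underline{A}_i=I-\frac{2}{\underline{v}_i}\begin{pmatrix} r_{ij} \\ x_{ij} \end{pmatrix}\begin{pmatrix}\hat P_{ij}(\overline{p})^+ & \hat Q_{ij}(\overline{q})^+\end{pmatrix}$. Leaves. $\mathcal{L}=\{l\in\mathcal{N}\mid \nexists k\in\mathcal{N}: k\to l\}$. For $l\in\mathcal{L}$, $n_l+1$ is the number of buses on $\mathcal{P}_l$, and $\mathcal{P}_l$ is written $l_{n_l}\to l_{n_l-1}\to\cdots\to l_1\to l_0$ with $l_{n_l}=l$, $l_0=0$. *)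

(* Defs.v *)
From HB Require Import structures.
From mathcomp Require Import all_boot all_order all_algebra.
From mathcomp Require Import boolp classical_sets reals.
From mathcomp Require Import complex.

Set Implicit Arguments.
Unset Strict Implicit.
Unset Printing Implicit Defensive.

Import Order.TTheory GRing.Theory Num.Theory.
Local Open Scope ring_scope.
Local Open Scope classical_set_scope.

Definition re (R : realType) (x : R[i]) : R := complex.Re x.
Definition im (R : realType) (x : R[i]) : R := complex.Im x.
Definition cabs (R : realType) (x : R[i]) : R := ComplexField.Normc.normc x.

(* [ucycle] allows [:: x; y] as a cycle (an edge traversed back and forth),
   so acyclicity only excludes simple cycles of length at least 3. *)
Definition is_tree (T : finType) (e : rel T) : Prop :=
  [/\ symmetric e, irreflexive e,
      forall x y, connect e x y
    & forall c : seq T, ucycle e c -> (size c <= 2)%N].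

(* The simple path from [i] to the root [ord0], without its starting point
   [i]; junk value [::] if there is none (impossible in a tree). *)
Definition route (n : nat) (e : rel 'I_n.+1) (i : 'I_n.+1) : seq 'I_n.+1 :=
  xget [::] [set p | [&& path e i p, uniq (i :: p) & last i p == ord0]].

Definition path_buses (n : nat) (e : rel 'I_n.+1) (i : 'I_n.+1) :=
  i :: route e i.

Definition path_lines (n : nat) (e : rel 'I_n.+1) (i : 'I_n.+1) :=
  zip (path_buses e i) (route e i).

Definition line (n : nat) (e : rel 'I_n.+1) (i j : 'I_n.+1) : bool :=
  e i j && (j \in path_buses e i).

(* Data indexed by lines are functions of two buses, and data indexed by
   non-root buses are functions of all buses; only the values on lines,
   resp. on non-root buses, are ever constrained or used. *)
Record network (R : realType) (n : nat) := Network {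
  adj : rel 'I_n.+1;
  imp : 'I_n.+1 -> 'I_n.+1 -> R[i];
  v0 : R;
  vmin : 'I_n.+1 -> R;
  vmax : 'I_n.+1 -> R;
  inj_set : 'I_n.+1 -> set R[i];
  cost : 'I_n.+1 -> R -> R;
  adj_tree : is_tree adj;
  imp_gt0 : forall i j, line adj i j -> 0 < re (imp i j) /\ 0 < im (imp i j);
  v0_ge0 : 0 <= v0;
  vmin_gt0 : forall i, i != ord0 -> 0 < vmin i
}.

(* The root value [s ord0] is the substation injection s_0; [feasible]
   forces [v ord0] to be the constant [v0].  The squared current l is [cur],
   the line flow S is [flow]. *)
Record opf_point (R : realType) (n : nat) := OpfPoint {
  inj : 'I_n.+1 -> R[i];
  flow : 'I_n.+1 -> 'I_n.+1 -> R[i];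
  volt : 'I_n.+1 -> R;
  cur : 'I_n.+1 -> 'I_n.+1 -> R
}.

Definition inflow (R : realType) (n : nat) (G : network R n)
    (w : opf_point R n) (i : 'I_n.+1) : R[i] :=
  \sum_(h | line (adj G) h i)
    (flow w h i - imp G h i * (real_complex R (cur w h i))).

Record socp_feasible (R : realType) (n : nat) (G : network R n)
    (w : opf_point R n) : Prop := SocpFeasible {
  balance : forall i j, line (adj G) i j ->
    flow w i j = inj w i + inflow G w i;
  balance_root : 0 = inj w ord0 + inflow G w ord0;
  volt_root : volt w ord0 = v0 G;
  volt_drop : forall i j, line (adj G) i j ->
    volt w i - volt w j =
      2 * re (conjc (imp G i j) * flow w i j)
      - cabs (imp G i j) ^+ 2 * cur w i j;
  cur_cone : forall i j, line (adj G) i j ->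
    cabs (flow w i j) ^+ 2 / volt w i <= cur w i j;
  inj_mem : forall i, i != ord0 -> inj_set G i (inj w i);
  volt_bounds : forall i, i != ord0 -> vmin G i <= volt w i <= vmax G i
}.

Definition objective (R : realType) (n : nat) (G : network R n)
    (w : opf_point R n) : R :=
  \sum_(i < n.+1) cost G i (re (inj w i)).

Definition socp_optimal (R : realType) (n : nat) (G : network R n)
    (w : opf_point R n) : Prop :=
  socp_feasible G w /\
  forall w', socp_feasible G w' -> objective G w <= objective G w'.

Definition socp_exact (R : realType) (n : nat) (G : network R n) : Prop :=
  forall w, socp_optimal G w -> forall i j, line (adj G) i j ->
    cur w i j = cabs (flow w i j) ^+ 2 / volt w i.

(* Common form of the lossless flows: with x = s, p, q this is the lossless
   complex, active, reactive flow on the line leaving [i] (i <> 0).  The sum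
   does not involve x_0, as the root's path contains no other bus. *)
Definition lossless (R : realType) (n : nat) (G : network R n)
    (V : nmodType) (x : 'I_n.+1 -> V) (i : 'I_n.+1) : V :=
  \sum_(h | i \in path_buses (adj G) h) x h.

Definition lossless_volt (R : realType) (n : nat) (G : network R n)
    (s : 'I_n.+1 -> R[i]) (i : 'I_n.+1) : R :=
  v0 G + 2 * \sum_(jk <- path_lines (adj G) i)
               re (conjc (imp G jk.1 jk.2) * lossless G s jk.1).

Definition S_volt (R : realType) (n : nat) (G : network R n) :
    set ('I_n.+1 -> R[i]) :=
  [set s | forall i, i != ord0 -> lossless_volt G s i <= vmax G i].

(* The end of the unique line leaving [i <> 0]. *)
Definition parent (n : nat) (e : rel 'I_n.+1) (i : 'I_n.+1) : 'I_n.+1 :=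
  odflt ord0 [pick j | line e i j].

Definition u_vec (R : realType) (n : nat) (G : network R n)
    (i : 'I_n.+1) : 'cV[R]_2 :=
  let z := imp G i (parent (adj G) i) in
  \col_k (if k == 0 then re z else im z).

Definition A_mat (R : realType) (n : nat) (G : network R n)
    (pmax qmax : 'I_n.+1 -> R) (i : 'I_n.+1) : 'M[R]_2 :=
  1%:M - (2 / vmin G i) *:
    (u_vec G i *m \row_k (if k == 0 then Num.max (lossless G pmax i) 0
                          else Num.max (lossless G qmax i) 0)).

Definition leaf (n : nat) (e : rel 'I_n.+1) (l : 'I_n.+1) : bool :=
  ~~ [exists k, line e k l].

Definition depth (n : nat) (e : rel 'I_n.+1) (l : 'I_n.+1) : nat :=
  (size (path_buses e l)).-1.

(* The bus l_t: buses on the path of [l] are numbered from the root. *)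
Definition path_bus (n : nat) (e : rel 'I_n.+1) (l : 'I_n.+1) (t : nat) :=
  nth ord0 (rev (path_buses e l)) t.

(* Main.v *)
Require Import Defs.
From HB Require Import structures.
From mathcomp Require Import all_boot all_order all_algebra.
From mathcomp Require Import boolp classical_sets reals.
From mathcomp Require Import complex.
From mathcomp Require Import ring lra zify.

Set Implicit Arguments.
Unset Strict Implicit.
Unset Printing Implicit Defensive.

Import Order.TTheory GRing.Theory Num.Theory.
Local Open Scope ring_scope.
Local Open Scope classical_set_scope.

(** The proof is by contradiction: an optimal point w with a strict cone
    inequality on some line can be improved at the substation.

    Freeze the voltages of w and recompute the flows from the leaves to the root
    with the current l' = |S'|^2 / v on every line ([exists_tight_flow]); then
    integrate the voltage drops from the root outwards ([tight_point]).  Only the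
    root injection changes, by minus the increment of the power that reaches the
    root, so everything rests on the sign of the increments.

    Let d_i be the increment of the power collected from the children of i, seen
    as a vector of R^2; for i <> 0 it is also S'_i - S_i.  The difference
    |S'|^2 - |S|^2 is bounded through (P' + P)(P' - P) + (Q' + Q)(Q' - Q), and
    the lossless flows of the bounds pmax, qmax dominate both S and S'.  If
    d_h >= 0 this gives
         d_h - z_h (l'_h - l_h) = A_h d_h + eps_h u_h    with eps_h >= 0,
    where eps_h is at least the slack l_h - |S_h|^2 / v_h ([eps_bound]).  Hence
    d_i is the sum of A_h d_h + eps_h u_h over the children h of i.

    Nonnegativity of d alone does not propagate through A_h, which may have
    negative entries.  What propagates is the stronger invariant that every
    product of the matrices A along the ancestors of i, ending with A_i, maps d_i
    to a nonnegative vector: the term A_h d_h only lengthens the product, and the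
    term eps_h u_h is handled by the positivity assumed along the paths of the
    leaves ([sweep_ge0]).  A positive slack makes the
    invariant strict all the way to the root ([root_increment_gt0]), so the real
    part of the root injection strictly decreases.

    The new point is feasible: its voltage increment over a line is
    Re (conj z d) + Re (conj z (d - z (l' - l))), a sum of two nonnegative terms,
    so v' >= v, which restores the cone inequality l' >= |S'|^2 / v'; and v' is
    at most the lossless voltage, which [S_volt] bounds
    by the upper limit. *)

(** * Rooted trees *)

(** If two simple paths with the same ends part at x, following one from its
    second vertex to the common end and the other one backwards joins the two
    successors of x without meeting x; closing through x gives a cycle of length
    at least 3. *)
Lemma tree_uniq_path (T : finType) (e : rel T) (x : T) (p q : seq T) :
  is_tree e -> path e x p -> uniq (x :: p) -> path e x q -> uniq (x :: q) ->
  last x p = last x q -> p = q.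
Proof.
move=> [sym irr _ acyc].
elim: p x q => [|a p IH] x [|b q] //=.
- by move=> _ _ _ /and3P[+ _ _] xl; rewrite xl mem_last.
- by move=> _ /and3P[+ _ _] _ _ xl; rewrite -xl mem_last.
move=> /andP[xa ap] /andP[xap uap] /andP[xb bq] /andP[xbq ubq] eql.
have [ab|neq_ab] := eqVneq a b.
  by subst b; congr (_ :: _); apply: (IH a).
exfalso.
pose r := p ++ rev (belast b q).
have ar : path e a r.
  rewrite cat_path ap eql rev_path /=; apply: sub_path bq => u v /=.
  by rewrite sym.
have lr : last a r = b.
  rewrite last_cat eql.
  by case: (q) => [|c q'] //=; rewrite rev_cons last_rcons.
have xr : x \notin a :: r.
  move: xap xbq; rewrite /r -cat_cons mem_cat negb_or => -> /=.
  rewrite mem_rev; apply: contra; exact: mem_belast.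
case: (shortenP ar) lr => r' ar' ur' sub lr'.
have xr' : x \notin a :: r'.
  apply: contra xr; rewrite !inE => /orP[->//|/sub ->]; exact: orbT.
have /acyc : ucycle e (x :: a :: r').
  by rewrite /ucycle cons_uniq xr' ur' !andbT /= rcons_path xa ar' lr' sym.
by case: r' lr' {ar' ur' sub xr'} => [/= ab|//]; rewrite ab eqxx in neq_ab.
Qed.

Section Tree.
Variables (n : nat) (e : rel 'I_n.+1).
Hypothesis tree : is_tree e.
Implicit Types i j h k l : 'I_n.+1.

Lemma routeP i :
  [/\ path e i (route e i), uniq (i :: route e i)
    & last i (route e i) = ord0].
Proof.
suff: [set p | [&& path e i p, uniq (i :: p) & last i p == ord0]] (route e i).
  by move=> /and3P[? ? /eqP].
have [_ _ conn _] := tree; have /connectP[p ip lp] := conn i ord0.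
case: (shortenP ip) lp => p' ip' up' _ lp'.
by apply: (@xgetI _ _ _ p'); apply/and3P; split=> //; apply/eqP.
Qed.

Lemma route_uniq i p :
  path e i p -> uniq (i :: p) -> last i p = ord0 -> route e i = p.
Proof.
have [rp ru rl] := routeP i.
by move=> ip up lp; apply: (tree_uniq_path tree rp ru ip up); rewrite rl lp.
Qed.

Lemma route_root : route e ord0 = [::].
Proof. exact: route_uniq. Qed.

(** Since e i j holds and j occurs on the route of i, the part of that route that
    starts at j, preceded by i, is another simple path to the root. *)
Lemma line_route i j : line e i j -> route e i = j :: route e j.
Proof.
have [_ irr _ _] := tree => /andP[eij]; rewrite /path_buses inE => /orP[/eqP ji|jr].
  by rewrite ji irr in eij.
have := routeP i; case/splitPr: jr => p1 p2 [ip up lp].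
move: (ip) (up) (lp); rewrite last_cat cat_path /= mem_cat cat_uniq negb_or /=.
move=> /and3P[_ _ jp2] /andP[/andP[_ ijp2]] /and4P[_ _ jp2' up2] l2.
have uj : uniq (j :: p2) by rewrite /= jp2'.
rewrite (route_uniq jp2 uj l2); apply: (tree_uniq_path tree ip up).
- by rewrite /= eij.
- by rewrite cons_uniq ijp2.
- by rewrite lp.
Qed.

Lemma line_nonroot i j : line e i j -> i != ord0.
Proof.
by move=> /line_route r; apply/eqP => i0; rewrite i0 route_root in r.
Qed.

Lemma line_parent i : i != ord0 -> line e i (parent e i).
Proof.
move=> i0; rewrite /parent; case: pickP => //= noline.
have [+ _ +] := routeP i.
case ri: (route e i) => [|j p] /=; first by move=> _ /eqP; rewrite (negPf i0).
move=> /andP[eij _] _.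
by have := noline j; rewrite /line eij /path_buses ri !inE eqxx orbT.
Qed.

Lemma lineE i j : line e i j = (i != ord0) && (j == parent e i).
Proof.
apply/idP/andP => [ij|[i0 /eqP->]]; last exact: line_parent.
have i0 := line_nonroot ij; split=> //; apply/eqP.
by have := line_route (line_parent i0); rewrite (line_route ij) => -[].
Qed.

Lemma path_buses_root : path_buses e ord0 = [:: ord0].
Proof. by rewrite /path_buses route_root. Qed.

Lemma path_buses_parent i : i != ord0 ->
  path_buses e i = i :: path_buses e (parent e i).
Proof. by move=> i0; rewrite /path_buses (line_route (line_parent i0)). Qed.

Lemma path_lines_root : path_lines e ord0 = [::].
Proof. by rewrite /path_lines route_root. Qed.

Lemma path_lines_parent i : i != ord0 ->
  path_lines e i = (i, parent e i) :: path_lines e (parent e i).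
Proof.
by move=> i0; rewrite /path_lines /path_buses (line_route (line_parent i0)).
Qed.

Lemma path_buses_uniq i : uniq (path_buses e i).
Proof. by have [] := routeP i. Qed.

Lemma depth_root : depth e ord0 = 0%N.
Proof. by rewrite /depth path_buses_root. Qed.

Lemma depth_line i j : line e i j -> depth e i = (depth e j).+1.
Proof. by move=> ij; rewrite /depth /= (line_route ij). Qed.

Lemma depth_max i : (depth e i <= n)%N.
Proof.
have := uniq_leq_size (path_buses_uniq i) (fun x _ => mem_enum 'I_n.+1 x).
by rewrite size_enum_ord /depth; case: (path_buses e i).
Qed.

Lemma tree_ind_up (P : 'I_n.+1 -> Prop) :
  (forall i, (forall h, line e h i -> P h) -> P i) -> forall i, P i.
Proof.
move=> IP i; have [m] := ubnP (n - depth e i)%N.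
elim: m i => // m IH i lt_m; apply: IP => h hi; apply: IH.
by have := depth_line hi; have := depth_max h; lia.
Qed.

Lemma tree_ind_down (P : 'I_n.+1 -> Prop) :
  P ord0 -> (forall i, i != ord0 -> P (parent e i) -> P i) -> forall i, P i.
Proof.
move=> P0 IP i; move: {2}(depth e i) (leqnn (depth e i)) => m.
elim: m i => [|m IH] i le_m; have [->//|i0] := eqVneq i ord0;
  apply: IP => //; have di := depth_line (line_parent i0); first by lia.
by apply: IH; lia.
Qed.

(** Recursion from the leaves: at fuel n + 1 - depth i the recursive calls on the
    children of i have exactly the fuel that their own depth prescribes. *)
Lemma tree_rec_up (X : nmodType) (x : 'I_n.+1 -> X) 
    (F : 'I_n.+1 -> X -> X) :
  exists f : 'I_n.+1 -> X, forall i, f i = x i + \sum_(h | line e h i) F h (f h).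
Proof.
pose f := fix f m i : X := if m is m'.+1 then
   x i + \sum_(h | line e h i) F h (f m' h) else 0.
exists (fun i => f (n - depth e i).+1 i) => i /=; congr (_ + _).
apply: eq_bigr => h hi.
have -> // : (n - depth e i = (n - depth e h).+1)%N.
by have := depth_line hi; have := depth_max h; lia.
Qed.

Lemma path_buses_sub i l :
  i \in path_buses e l -> {subset path_buses e i <= path_buses e l}.
Proof.
elim/tree_ind_down: l => [|l l0 IH].
  by rewrite path_buses_root inE => /eqP->; rewrite path_buses_root.
rewrite path_buses_parent // in_cons => /orP[/eqP->|/IH sub x /sub xp].
  by rewrite path_buses_parent.
by rewrite in_cons xp orbT.
Qed.

Lemma line_mem_path_buses i j : line e i j -> j \in path_buses e i.
Proof. by case/andP. Qed.

(** Buses are numbered from the root, so the number of a bus does not depend on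
    the descendant whose path is considered. *)
Lemma path_busE i t : (t <= depth e i)%N ->
  forall l, i \in path_buses e l -> path_bus e l t = path_bus e i t.
Proof.
move=> lt; apply: tree_ind_down => [|l l0 IH].
  by rewrite path_buses_root inE => /eqP->.
rewrite path_buses_parent // inE => /orP[/eqP->//|ip].
rewrite -IH // /path_bus path_buses_parent // rev_cons nth_rcons size_rev.
suff -> : (t < size (path_buses e (parent e l)))%N by [].
apply: leq_ltn_trans lt _; rewrite /depth prednK //.
exact: uniq_leq_size (path_buses_uniq i) (path_buses_sub ip).
Qed.

Lemma path_bus_depth i : path_bus e i (depth e i) = i.
Proof. by rewrite /path_bus nth_rev /depth //= subnn. Qed.

(** Transfers to every bus a hypothesis that speaks of the paths of leaves. *)
Lemma exists_leaf_below i : exists2 l, leaf e l & i \in path_buses e l.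
Proof.
elim/tree_ind_up: i => i IH.
have [/existsP[k ki]|] := boolP [exists k, line e k i]; last first.
  by exists i => //; rewrite inE eqxx.
have [l ll kl] := IH k ki; exists l => //.
exact: path_buses_sub kl _ (line_mem_path_buses ki).
Qed.

(** The subtree of i is the disjoint union of i and of the subtrees of its
    children, expressed pointwise at h. *)
Lemma mem_path_buses_count h i :
  ((i \in path_buses e h) =
   (h == i) + \sum_(k | line e k i) (k \in path_buses e h) :> nat)%N.
Proof.
elim/tree_ind_down: h i => [|h h0 IH] i.
  rewrite path_buses_root inE eq_sym big1 ?addn0 // => k ki.
  by rewrite inE (negPf (line_nonroot ki)).
have := path_buses_uniq h; rewrite path_buses_parent //= => /andP[hp _].
under eq_bigr => k _ do rewrite inE.
have -> : (\sum_(k | line e k i) ((k == h) || (k \in path_buses e (parent e h)))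
  = line e h i + \sum_(k | line e k i) (k \in path_buses e (parent e h)))%N.
  have -> : (line e h i = \sum_(k | line e k i) (k == h) :> nat)%N.
    rewrite big_mkcond (bigD1 h) //= eqxx big1 ?addn0 ?if_same => [|k /negPf->].
      by case: line.
    by rewrite if_same.
  rewrite -big_split; apply: eq_bigr => k _ /=.
  by have [->|] := eqVneq k h; rewrite ?(negPf hp).
rewrite lineE h0 /= [(i == _)%B]eq_sym -IH inE eq_sym.
by have [<-|] := eqVneq h i; rewrite ?(negPf hp).
Qed.

End Tree.

(** * Active and reactive parts *)

Section ComplexParts.
Variable R : realType.
Implicit Types x y z : R[i].

Lemma re_is_zmod_morphism : zmod_morphism (@re R).
Proof. by case=> a b [c d]. Qed.
HB.instance Definition _ :=
  GRing.isZmodMorphism.Build R[i] R (@re R) re_is_zmod_morphism.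

Lemma im_is_zmod_morphism : zmod_morphism (@im R).
Proof. by case=> a b [c d]. Qed.
HB.instance Definition _ :=
  GRing.isZmodMorphism.Build R[i] R (@im R) im_is_zmod_morphism.

Lemma reB x y : re (x - y) = re x - re y.
Proof. exact: raddfB. Qed.

Lemma imB x y : im (x - y) = im x - im y.
Proof. exact: raddfB. Qed.

Lemma re_scale z (a : R) : re (z * real_complex R a) = re z * a.
Proof. by case: z => x y; rewrite /re /= mulr0 subr0. Qed.

Lemma im_scale z (a : R) : im (z * real_complex R a) = im z * a.
Proof. by case: z => x y; rewrite /im /= mulr0 add0r. Qed.

Lemma re_conjM z y : re (conjc z * y) = re z * re y + im z * im y.
Proof. by case: z y => a b [c d]; rewrite /re /im /= mulNr opprK. Qed.

Lemma cabs_sqr z : cabs z ^+ 2 = re z ^+ 2 + im z ^+ 2.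
Proof.
by case: z => a b; rewrite /cabs /re /im /= sqr_sqrtr // addr_ge0 ?sqr_ge0.
Qed.

(** Factor each p'^2 - p^2 as (p' + p)(p' - p): the second factor is
    nonnegative and the first is at most 2P.  Replacing P by its positive part
    makes the bound nonnegative, which allows v to be replaced by vm. *)
Lemma cabs_sqr_diff_le (S S' : R[i]) (P Q v vm : R) :
  0 < vm -> vm <= v -> re S <= P -> re S' <= P -> im S <= Q -> im S' <= Q ->
  0 <= re (S' - S) -> 0 <= im (S' - S) ->
  cabs S' ^+ 2 / v - cabs S ^+ 2 / v <=
    2 / vm * (Num.max P 0 * re (S' - S) + Num.max Q 0 * im (S' - S)).
Proof.
rewrite !raddfB /= !cabs_sqr => vm0 vmv.
move: (re S) (re S') (im S) (im S') => p p' q q' pP p'P qQ q'Q dp dq.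
have v0 : 0 < v by apply: lt_le_trans vmv.
set B := Num.max P 0 * _ + _.
have PP : P <= Num.max P 0 by rewrite le_max lexx.
have QQ : Q <= Num.max Q 0 by rewrite le_max lexx.
have P0 : 0 <= Num.max P 0 by rewrite le_max lexx orbT.
have Q0 : 0 <= Num.max Q 0 by rewrite le_max lexx orbT.
have B0 : 0 <= B by apply: addr_ge0; apply: mulr_ge0.
apply: (@le_trans _ _ (2 * B / v)).
  rewrite -mulrBl ler_pM2r ?invr_gt0 // /B.
  move: PP QQ; move: (Num.max P 0) (Num.max Q 0) => P' Q' PP QQ; nra.
rewrite mulrAC ler_wpM2r // ler_pM2l ?ltr0n //.
by rewrite lef_pV2 ?posrE.
Qed.

End ComplexParts.

(** * Lossless flows and voltages *)

Section Network.
Variables (R : realType) (n : nat) (G : network R n).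
Implicit Types (i h : 'I_n.+1).

Let e := adj G.
Let tree : is_tree e := adj_tree G.
Let par := parent e.

Definition line_imp i : R[i] := imp G i (par i).

Lemma line_imp_gt0 i : i != ord0 -> 0 < re (line_imp i) /\ 0 < im (line_imp i).
Proof. by move=> /(line_parent tree) /imp_gt0. Qed.

Lemma losslessE (V : nmodType) (x : 'I_n.+1 -> V) i :
  lossless G x i = x i + \sum_(h | line e h i) lossless G x h.
Proof.
have mulrnE k : lossless G x k = \sum_h x h *+ (k \in path_buses e h).
  by rewrite /lossless big_mkcond; apply: eq_bigr => h _; rewrite mulrb.
under [X in _ = _ + X]eq_bigr => k _ do rewrite mulrnE.
rewrite mulrnE exchange_big /=.
under eq_bigr => h _ do rewrite (mem_path_buses_count tree h i) mulrnDr -sumrMnr.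
rewrite big_split; congr (_ + _).
by rewrite (bigD1 i) //= eqxx big1 ?addr0 // => h /negPf->.
Qed.

Lemma le_lossless (a x : 'I_n.+1 -> R) :
  (forall i, i != ord0 -> a i <= x i + \sum_(h | line e h i) a h) ->
  forall i, i != ord0 -> a i <= lossless G x i.
Proof.
move=> ax; elim/(tree_ind_up tree) => i IH i0.
rewrite losslessE; apply: le_trans (ax i i0) _; rewrite lerD2l.
by apply: ler_sum => h hi; apply: IH (line_nonroot tree hi).
Qed.

Lemma lossless_additive (V W : nmodType) (f : {additive V -> W})
    (x : 'I_n.+1 -> V) i :
  f (lossless G x i) = lossless G (f \o x) i.
Proof. by rewrite raddf_sum. Qed.

(** Losses only remove power, since both parts of an impedance are positive. *)
Lemma lossy_flow_le (s T : 'I_n.+1 -> R[i]) (loss : 'I_n.+1 -> R) :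
  (forall i, i != ord0 -> T i =
     s i + \sum_(h | line e h i) (T h - line_imp h * real_complex R (loss h))) ->
  (forall i, i != ord0 -> 0 <= loss i) ->
  forall i, i != ord0 ->
    re (T i) <= lossless G (@re R \o s) i /\
    im (T i) <= lossless G (@im R \o s) i.
Proof.
move=> TE loss0 i i0; split; move: i i0; apply: le_lossless => i i0.
  rewrite TE // raddfD raddf_sum /= lerD2l; apply: ler_sum => h hi.
  have h0 := line_nonroot tree hi; have [rz _] := line_imp_gt0 h0.
  by rewrite raddfB /= re_scale gerBl mulr_ge0 ?loss0 // ltW.
rewrite TE // raddfD raddf_sum /= lerD2l; apply: ler_sum => h hi.
have h0 := line_nonroot tree hi; have [_ xz] := line_imp_gt0 h0.
by rewrite raddfB /= im_scale gerBl mulr_ge0 ?loss0 // ltW.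
Qed.

Lemma lossless_volt_root (s : 'I_n.+1 -> R[i]) : lossless_volt G s ord0 = v0 G.
Proof. by rewrite /lossless_volt path_lines_root // big_nil mulr0 addr0. Qed.

Lemma lossless_volt_parent (s : 'I_n.+1 -> R[i]) i : i != ord0 ->
  lossless_volt G s i =
  lossless_volt G s (par i) + 2 * re (conjc (line_imp i) * lossless G s i).
Proof.
by move=> i0; rewrite /lossless_volt path_lines_parent // big_cons /=; lra.
Qed.

Definition cvec (z : R[i]) : 'cV[R]_2 := \col_k (if k == 0 then re z else im z).

Lemma cvec_is_zmod_morphism : zmod_morphism cvec.
Proof.
by move=> x y; apply/colP=> k; rewrite !mxE; case: eqP; rewrite raddfB.
Qed.
HB.instance Definition _ :=
  GRing.isZmodMorphism.Build R[i] 'cV[R]_2 cvec cvec_is_zmod_morphism.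

Lemma cvec_ge0 (x : R[i]) :
  (forall k, 0 <= cvec x k ord0) <-> 0 <= re x /\ 0 <= im x.
Proof.
split=> [x0|[x0 y0] k]; last by rewrite mxE; case: ifP.
by split; [have := x0 0|have := x0 1]; rewrite mxE.
Qed.

Lemma cvec_scale z (a : R) : cvec (z * real_complex R a) = a *: cvec z.
Proof.
apply/colP=> k; rewrite !mxE; case: eqP => _.
  by rewrite re_scale mulrC.
by rewrite im_scale mulrC.
Qed.

(** * Propagation of increments along the tree *)

Section Chains.
Variables pmax qmax : 'I_n.+1 -> R.
Let A := A_mat G pmax qmax.
Let dep := depth e.

Lemma A_mat_cvec i z :
  A i *m cvec z = cvec z - (2 / vmin G i *
    (Num.max (lossless G pmax i) 0 * re z
     + Num.max (lossless G qmax i) 0 * im z)) *: cvec (line_imp i).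
Proof.
rewrite /A /A_mat mulmxBl mul1mx -scalemxAl -mulmxA; congr (_ - _).
rewrite -scalerA; congr (_ *: _).
apply/colP=> k; rewrite [u_vec G i](_ : _ = cvec (line_imp i)) //.
by rewrite mxE big_ord1 !mxE !big_ord_recl big_ord0 !mxE /= addr0 mulrC.
Qed.

(** The factor at i itself is included, so that the invariant at s = depth i + 1,
    where the product is empty, is plain nonnegativity. *)
Definition chain (s : nat) i : 'M[R]_2 :=
  \prod_(s <= m < (dep i).+1) A (path_bus e i m).

Lemma chain_above s i : (dep i < s)%N -> chain s i = 1%:M.
Proof. by move=> lt; rewrite /chain big_geq. Qed.

Lemma dep_parent i : i != ord0 -> dep i = (dep (par i)).+1.
Proof. by move=> i0; exact: (depth_line tree (line_parent tree i0)). Qed.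

Lemma path_bus_parent i m : i != ord0 -> (m <= dep (par i))%N ->
  path_bus e i m = path_bus e (par i) m.
Proof.
move=> i0 lm; apply: (path_busE tree lm).
exact: line_mem_path_buses (line_parent tree i0).
Qed.

Lemma chain_step s i : i != ord0 -> (s <= dep i)%N ->
  chain s i = chain s (par i) *m A i.
Proof.
move=> i0 si; rewrite /chain big_nat_recr //= path_bus_depth -dep_parent //.
congr (_ *m A i).
apply: eq_big_nat => m /andP[_ lm].
by rewrite path_bus_parent // -ltnS -dep_parent.
Qed.

Definition leaf_chain_gt0 := forall l, leaf e l -> forall s t : nat,
  (1 <= s)%N -> (s <= t)%N -> (t <= depth e l)%N -> forall k : 'I_2,
  0 < ((\prod_(s <= m < t) A (path_bus e l m))
         *m u_vec G (path_bus e l t)) k ord0.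

Hypothesis C1 : leaf_chain_gt0.

(** Buses on the path of i have the same numbers on the path of a leaf below i. *)
Lemma chain_imp_gt0 i s : i != ord0 -> (1 <= s <= dep i)%N ->
  forall k, 0 < (chain s (par i) *m cvec (line_imp i)) k ord0.
Proof.
move=> i0 /andP[s1 si] k; have [l ll il] := exists_leaf_below tree i.
have dl : (dep i <= dep l)%N.
  exact: uniq_leq_size (path_buses_uniq tree i) (path_buses_sub tree il).
have := C1 ll s1 si dl k.
rewrite (path_busE tree (leqnn _) il) path_bus_depth.
suff -> : \prod_(s <= m < dep i) A (path_bus e l m) = chain s (par i) by [].
rewrite /chain -dep_parent //; apply: eq_big_nat => m /andP[_ lm].
rewrite (path_busE tree (ltnW lm) il) path_bus_parent //.
by rewrite -ltnS -dep_parent.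
Qed.

(** An abstract sweep towards the root, in which each line adds a nonnegative
    multiple of its impedance vector; that multiple is known to be nonnegative only
    once the increment arriving at the line is. *)
Section Sweep.
Variables (d : 'I_n.+1 -> 'cV[R]_2) (eps : 'I_n.+1 -> R).
Hypothesis dE : forall i, d i =
  \sum_(h | line e h i) (A h *m d h + eps h *: cvec (line_imp h)).
Hypothesis eps_ge0 : forall h, h != ord0 ->
  (forall k, 0 <= d h k ord0) -> 0 <= eps h.

Lemma chain_sweep s i k : (s <= (dep i).+1)%N ->
  (chain s i *m d i) k ord0 =
  \sum_(h | line e h i) ((chain s h *m d h) k ord0
     + eps h * (chain s i *m cvec (line_imp h)) k ord0).
Proof.
move=> si; rewrite dE mulmx_sumr summxE; apply: eq_bigr => h hi.
have h0 := line_nonroot tree hi; move: (hi); rewrite lineE // => /andP[_ /eqP ip].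
rewrite mulmxDr -scalemxAr mulmxA mxE [in X in _ + X]mxE ip -chain_step //.
by have -> : dep h = (dep i).+1 := depth_line tree hi.
Qed.

(** The invariant is about all products of ancestor matrices, because A does not
    preserve the nonnegative quadrant.  For a child h of i, chain s i (A_h d_h) is
    chain s h d_h, an instance of the invariant at h, and chain s i u_h is positive
    by [chain_imp_gt0]. *)
Lemma sweep_ge0 i s k : (1 <= s <= (dep i).+1)%N -> 0 <= (chain s i *m d i) k ord0.
Proof.
elim/(tree_ind_up tree): i s k => i IH s k /andP[s1 si].
rewrite chain_sweep //; apply: sumr_ge0 => h hi.
have h0 := line_nonroot tree hi; move: (hi); rewrite lineE // => /andP[_ /eqP ip].
have dh : dep h = (dep i).+1 := depth_line tree hi.
apply: addr_ge0; first by apply: IH => //; rewrite s1 dh leqW.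
apply: mulr_ge0.
  apply: eps_ge0 => // k'.
  have := IH h hi (dep h).+1 k'; rewrite chain_above // mul1mx; apply.
  by rewrite leqnn.
by rewrite ip; apply/ltW/chain_imp_gt0 => //; rewrite s1 dh.
Qed.

Lemma increment_ge0 i k : 0 <= d i k ord0.
Proof.
by have := @sweep_ge0 i (dep i).+1 k; rewrite chain_above // mul1mx leqnn; apply.
Qed.

Lemma line_increment_ge0 h k : h != ord0 ->
  0 <= (A h *m d h + eps h *: cvec (line_imp h)) k ord0.
Proof.
move=> h0; have [rz xz] := line_imp_gt0 h0; have dh := dep_parent h0.
rewrite mxE [in X in _ + X]mxE addr_ge0 //.
  have := @sweep_ge0 h (dep h) k; rewrite chain_step // chain_above ?dh //.
  by rewrite mul1mx leqnSn; apply.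
apply: mulr_ge0; first by apply: eps_ge0 => // k'; apply: increment_ge0.
by rewrite mxE; case: ifP => _; apply: ltW.
Qed.

(** A line on which eps is positive makes the invariant strict at its parent, and
    strictness then passes from each bus to its parent. *)
Lemma root_increment_gt0 b : b != ord0 -> 0 < eps b -> forall k, 0 < d ord0 k ord0.
Proof.
move=> b0 epsb.
suff: forall i, (i != ord0 /\ 0 < eps i) \/
    (forall s k, (1 <= s <= (dep i).+1)%N -> 0 < (chain s i *m d i) k ord0) ->
  forall k, 0 < d ord0 k ord0 by apply; left; split; [exact: b0|].
apply: (tree_ind_down tree) => [[[]|]|i i0 IH pos_i].
- by rewrite eqxx.
- have d0 : dep ord0 = 0%N := depth_root tree.
  by move=> + k => /(_ 1%N k); rewrite chain_above ?d0 // mul1mx; apply.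
apply: IH; right => s k /andP[s1 sp].
have ip := line_parent tree i0; have di : dep i = (dep (par i)).+1 := depth_line tree ip.
rewrite chain_sweep // (bigD1 i) //=.
have ge0 h : line e h (par i) -> 0 <= (chain s h *m d h) k ord0 /\
    0 <= eps h * (chain s (par i) *m cvec (line_imp h)) k ord0.
  move=> hp; have dh : dep h = (dep (par i)).+1 := depth_line tree hp.
  have h0 := line_nonroot tree hp; move: (hp); rewrite lineE // => /andP[_ /eqP ph].
  split; first by apply: sweep_ge0; rewrite s1 dh leqW.
  rewrite mulr_ge0 //; first by apply: eps_ge0 => // k'; apply: increment_ge0.
  by rewrite ph; apply/ltW/chain_imp_gt0 => //; rewrite s1 dh.
apply: ltr_wpDr.
  by apply: sumr_ge0 => h /andP[/ge0[? ?] _]; rewrite addr_ge0.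
have [ge1 ge2] := ge0 i ip.
case: pos_i => [[_ epsi]|pos_i].
  apply: ltr_wpDl => //; apply: mulr_gt0 => //.
  by apply: chain_imp_gt0 => //; rewrite s1 di.
by apply: ltr_wpDr => //; apply: pos_i; rewrite s1 di leqW.
Qed.

End Sweep.
End Chains.
End Network.

(** * The improved point *)

Section Improvement.
Variables (R : realType) (n : nat) (G : network R n).
Variables (pmax qmax : 'I_n.+1 -> R) (w : opf_point R n).
Hypothesis inj_bounded : forall i, i != ord0 ->
  inj_set G i `<=` [set s | re s <= pmax i /\ im s <= qmax i].
Hypothesis C1 : leaf_chain_gt0 G pmax qmax.
Hypothesis feas : socp_feasible G w.
Implicit Types i h : 'I_n.+1.

Let e := adj G.
Let tree : is_tree e := adj_tree G.
Let par := parent e.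
Let z := line_imp G.
Let S i : R[i] := flow w i (par i).
Let L i : R := cur w i (par i).

Lemma volt_gt0 i : i != ord0 -> 0 < volt w i.
Proof.
by move=> i0; have /andP[+ _] := volt_bounds feas i0; apply/lt_le_trans/vmin_gt0.
Qed.

Lemma inflow_parent (w' : opf_point R n) i : inflow G w' i =
  \sum_(h | line e h i)
    (flow w' h (par h) - z h * real_complex R (cur w' h (par h))).
Proof.
by apply: eq_bigr => h; rewrite lineE // => /andP[_ /eqP ->].
Qed.

Lemma flowE i : i != ord0 ->
  S i = inj w i + \sum_(h | line e h i) (S h - z h * real_complex R (L h)).
Proof.
by move=> i0; rewrite -inflow_parent; exact: (balance feas (line_parent tree i0)).
Qed.

Lemma cone_parent i : i != ord0 -> cabs (S i) ^+ 2 / volt w i <= L i.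
Proof. by move=> i0; exact: (cur_cone feas (line_parent tree i0)). Qed.

Lemma cabs_div_ge0 (x : R[i]) i : i != ord0 -> 0 <= cabs x ^+ 2 / volt w i.
Proof. by move=> i0; rewrite divr_ge0 ?sqr_ge0 // ltW // volt_gt0. Qed.

(** The losses use the old voltages, so that the flows can be computed from the
    leaves before any new voltage is known. *)
Lemma exists_tight_flow : exists T : 'I_n.+1 -> R[i], forall i,
  T i = inj w i + \sum_(h | line e h i)
    (T h - z h * real_complex R (cabs (T h) ^+ 2 / volt w h)).
Proof.
exact: (@tree_rec_up _ _ tree _ (inj w)
  (fun h y => y - z h * real_complex R (cabs y ^+ 2 / volt w h))).
Qed.

(** T and M are the recomputed flows S' and currents l'. *)
Section TightFlow.
Variable T : 'I_n.+1 -> R[i].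
Let M i : R := cabs (T i) ^+ 2 / volt w i.
Hypothesis TE : forall i,
  T i = inj w i + \sum_(h | line e h i) (T h - z h * real_complex R (M h)).

Lemma lossless_inj_le i : i != ord0 ->
  lossless G (@re R \o inj w) i <= lossless G pmax i /\
  lossless G (@im R \o inj w) i <= lossless G qmax i.
Proof.
move=> i0; split; move: i i0; apply: le_lossless => i i0; rewrite losslessE lerD2r;
  by have [] := inj_bounded i0 (inj_mem feas i0).
Qed.

Lemma tight_flow_le i : i != ord0 ->
  re (T i) <= lossless G (@re R \o inj w) i /\
  im (T i) <= lossless G (@im R \o inj w) i.
Proof. by apply: lossy_flow_le => // h h0; apply: cabs_div_ge0. Qed.

Lemma flow_le i : i != ord0 ->
  re (S i) <= lossless G (@re R \o inj w) i /\
  im (S i) <= lossless G (@im R \o inj w) i.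
Proof.
apply: lossy_flow_le (flowE) _ _ => h h0.
exact: le_trans (cabs_div_ge0 _ h0) (cone_parent h0).
Qed.

Let d i : R[i] :=
  \sum_(h | line e h i) (T h - S h - z h * real_complex R (M h - L h)).

Lemma flow_increment i : i != ord0 -> T i - S i = d i.
Proof.
move=> i0; rewrite TE flowE // opprD addrACA subrr add0r -sumrB.
by apply: eq_bigr => h _; rewrite rmorphB; ring.
Qed.

(** Chosen so that A_h d_h + eps_h u_h = d_h - z_h (l'_h - l_h): it is the gap
    between the linear bound encoded in A_h and the actual change of current. *)
Let eps i : R := 2 / vmin G i *
  (Num.max (lossless G pmax i) 0 * re (d i)
   + Num.max (lossless G qmax i) 0 * im (d i)) - (M i - L i).

Lemma inflow_increment_sweep i : cvec (d i) = \sum_(h | line e h i)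
  (A_mat G pmax qmax h *m cvec (d h) + eps h *: cvec (z h)).
Proof.
rewrite raddf_sum; apply: eq_bigr => h hi /=.
rewrite (flow_increment (line_nonroot tree hi)) raddfB /= cvec_scale A_mat_cvec /eps.
by rewrite [in RHS]scalerBl addrA subrK.
Qed.

Lemma eps_bound h : h != ord0 -> 0 <= re (d h) -> 0 <= im (d h) ->
  L h - cabs (S h) ^+ 2 / volt w h <= eps h.
Proof.
move=> h0 dp dq; have [sp sq] := flow_le h0; have [tp tq] := tight_flow_le h0.
have [lp lq] := lossless_inj_le h0.
have /andP[vm _] := volt_bounds feas h0.
have := @cabs_sqr_diff_le R (S h) (T h) _ _ _ _ (vmin_gt0 G h0) vm
  (le_trans sp lp) (le_trans tp lp) (le_trans sq lq) (le_trans tq lq).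
rewrite flow_increment // => /(_ dp dq); rewrite /eps /M; lra.
Qed.

Lemma eps_ge0 h : h != ord0 -> (forall k, 0 <= cvec (d h) k ord0) -> 0 <= eps h.
Proof.
move=> h0 /cvec_ge0[dp dq]; apply: le_trans (eps_bound h0 dp dq).
by rewrite subr_ge0 cone_parent.
Qed.

Lemma inflow_increment_ge0 i : 0 <= re (d i) /\ 0 <= im (d i).
Proof.
by apply/cvec_ge0 => k; apply: (increment_ge0 C1 inflow_increment_sweep eps_ge0).
Qed.

Lemma root_inflow_increment_gt0 b :
  b != ord0 -> cabs (S b) ^+ 2 / volt w b < L b -> 0 < re (d ord0).
Proof.
move=> b0 slack; have [dp dq] := inflow_increment_ge0 b.
have epsb : 0 < eps b by apply: lt_le_trans (eps_bound b0 dp dq); rewrite subr_gt0.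
by have := root_increment_gt0 C1 inflow_increment_sweep eps_ge0 b0 epsb 0; rewrite mxE.
Qed.

(** The increment that leaves a line is one summand of the sweep, nonnegative on
    its own. *)
Lemma line_gain_ge0 h : h != ord0 ->
  0 <= re (d h - z h * real_complex R (M h - L h)) /\
  0 <= im (d h - z h * real_complex R (M h - L h)).
Proof.
move=> h0; apply/cvec_ge0 => k.
have := line_increment_ge0 C1 inflow_increment_sweep eps_ge0 k h0.
rewrite A_mat_cvec raddfB /= cvec_scale /eps; congr (0 <= fun_of_matrix _ _ _).
by rewrite [in LHS]scalerBl addrA subrK.
Qed.

Definition tight_volt i : R := v0 G + \sum_(jk <- path_lines e i)
  (2 * re (conjc (imp G jk.1 jk.2) * T jk.1) - cabs (imp G jk.1 jk.2) ^+ 2 * M jk.1).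

Lemma tight_volt_root : tight_volt ord0 = v0 G.
Proof. by rewrite /tight_volt path_lines_root // big_nil addr0. Qed.

Lemma tight_volt_drop i : i != ord0 ->
  tight_volt i - tight_volt (par i) =
  2 * re (conjc (z i) * T i) - cabs (z i) ^+ 2 * M i.
Proof.
by move=> i0; rewrite /tight_volt path_lines_parent // big_cons /= /z /line_imp; lra.
Qed.

(** Over a line the voltage increment grows by Re (conj z d) +
    Re (conj z (d - z (l' - l))), where d and d - z (l' - l) are the increments of
    power at the two ends of the line. *)
Lemma volt_le_tight i : volt w i <= tight_volt i.
Proof.
elim/(tree_ind_down tree): i => [|i i0 IH].
  by rewrite tight_volt_root (volt_root feas).
have drop := volt_drop feas (line_parent tree i0).
have drop' := tight_volt_drop i0.
rewrite -/(par i) -/(S i) -/(L i) -[imp G i (par i)]/(z i) in drop.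
move: drop drop' (inflow_increment_ge0 i) (line_gain_ge0 i0) (line_imp_gt0 G i0).
rewrite -/(z i).
rewrite !reB !imB !re_scale !im_scale -flow_increment // !reB !imB !re_conjM !cabs_sqr.
rewrite -/par in IH.
move: IH; move: (volt w i) (volt w (par i)) (tight_volt i) (tight_volt (par i)).
move: (re (z i)) (im (z i)) (re (T i)) (im (T i)) (re (S i)) (im (S i)) (M i) (L i).
move=> r x tp tq sp sq m l vi vp ti tp' IH drop drop' [d1 d2] [e1 e2] [r0 x0].
nra.
Qed.

Lemma tight_volt_le_lossless i : tight_volt i <= lossless_volt G (inj w) i.
Proof.
elim/(tree_ind_down tree): i => [|i i0 IH].
  by rewrite tight_volt_root lossless_volt_root.
rewrite lossless_volt_parent //; apply: (le_trans _ (lerD IH (lexx _))).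
rewrite -lerBlDl tight_volt_drop // lerBlDr.
have [r0 x0] := line_imp_gt0 G i0; have [p q] := tight_flow_le i0.
apply: le_trans (_ : 2 * re (conjc (z i) * lossless G (inj w) i) <= _); last first.
  by rewrite lerDl mulr_ge0 ?sqr_ge0 // cabs_div_ge0.
rewrite ler_pM2l ?ltr0n // !re_conjM !lossless_additive.
by rewrite lerD // ler_wpM2l // ltW.
Qed.

Definition tight_point : opf_point R n := OpfPoint
  (fun i => if i == ord0
     then - \sum_(h | line e h ord0) (T h - z h * real_complex R (M h))
     else inj w i)
  (fun i _ => T i) tight_volt (fun i _ => M i).

Lemma tight_point_feasible : S_volt G (inj w) -> socp_feasible G tight_point.
Proof.
move=> volt_ok; split=> [i j|||i j|i j|i i0|i i0].
- move=> /(line_nonroot tree) i0.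
  by rewrite inflow_parent /= (negPf i0) TE.
- by rewrite inflow_parent /= addNr.
- exact: tight_volt_root.
- by rewrite lineE // => /andP[i0 /eqP->]; exact: tight_volt_drop.
- move=> /(line_nonroot tree) i0 /=; rewrite ler_wpM2l ?sqr_ge0 //.
  have v0 := volt_gt0 i0.
  by rewrite lef_pV2 ?posrE ?volt_le_tight // (lt_le_trans v0) ?volt_le_tight.
- by rewrite /= (negPf i0); exact: (inj_mem feas i0).
- have /andP[vm _] := volt_bounds feas i0; apply/andP; split.
    exact: le_trans vm (volt_le_tight i).
  exact: le_trans (tight_volt_le_lossless i) (volt_ok i i0).
Qed.

Lemma tight_point_cheaper b :
  {homo cost G ord0 : x y / x < y} -> b != ord0 ->
  cabs (S b) ^+ 2 / volt w b < L b -> objective G tight_point < objective G w.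
Proof.
move=> cost_incr b0 slack.
rewrite /objective (bigD1 ord0) //= [X in _ < X](bigD1 ord0) //=.
rewrite (eq_bigr (fun i => cost G i (re (inj w i)))) => [|i /negPf-> //].
rewrite ltrD2r; apply: cost_incr.
have -> : inj w ord0 = - inflow G w ord0.
  by apply/eqP; rewrite -addr_eq0 -(balance_root feas).
rewrite -subr_gt0 -reB; apply: etrans (root_inflow_increment_gt0 b0 slack).
congr (0 < re _); rewrite inflow_parent opprK addrC -sumrB.
by apply: eq_bigr => h _; rewrite rmorphB -/(S h) -/(L h); ring.
Qed.

End TightFlow.

End Improvement.

Theorem theorem1 (R : realType) (n : nat) (hn : (1 <= n)%N)
  (G : network R n) (pmax qmax : 'I_n.+1 -> R)
  (cost0_incr : {homo cost G ord0 : x y / x < y})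
  (inj_bounded : forall i, i != ord0 ->
     inj_set G i `<=` [set s | re s <= pmax i /\ im s <= qmax i])
  (C1 : forall l, leaf (adj G) l -> forall s t : nat,
     (1 <= s)%N -> (s <= t)%N -> (t <= depth (adj G) l)%N ->
     forall k : 'I_2,
       0 < ((\prod_(s <= m < t) A_mat G pmax qmax (path_bus (adj G) l m))
              *m u_vec G (path_bus (adj G) l t)) k ord0)
  (C2 : forall w, socp_optimal G w -> S_volt G (inj w)) :
  socp_exact G.
Proof.
move=> w w_opt i j ij; have [feas w_min] := w_opt.
have i0 := line_nonroot (adj_tree G) ij.
move: (ij); rewrite lineE; last exact: adj_tree.
move=> /andP[_ /eqP jp]; rewrite jp.
apply/eqP; rewrite eq_le leNgt cone_parent // andbT; apply/negP => slack.
have [T TE] := exists_tight_flow G w.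
have := w_min _ (tight_point_feasible inj_bounded C1 feas TE (C2 w w_opt)).
by rewrite leNgt (tight_point_cheaper inj_bounded C1 feas TE cost0_incr i0 slack).
Qed.
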